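(* Let $(A,\mathfrak{m})$ be a Noetherian equicharacteristic local ring of dimension $d>0$, $M$ a maximal Cohen–Macaulay $A$-module, and $I$ an $\mathfrak{m}$-primary ideal with $\mu(I)=d+1$. Then the Hilbert function of $M$ with respect to $I$, $n\mapsto\lambda(I^nM/I^{n+1}M)$, is non-decreasing.
   Context: Equicharacteristic: $A$ and $A/\mathfrak{m}$ have the same characteristic. $\mu(I)$ is the minimal number of generators of $I$. MCM: $\operatorname{depth}M=\dim A$. *)

(* Defs.v *)
From HB Require Import structures.
From mathcomp Require Import all_boot all_order all_algebra.
Set Implicit Arguments. Unset Strict Implicit. Unset Printing Implicit Defensive.
Import Order.TTheory GRing.Theory.
Local Open Scope ring_scope.

Section CommAlg.
Variable R : comNzRingType.

Definition subsetP {T : Type} (P Q : T -> Prop) := forall x, P x -> Q x.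
Definition seteqP {T : Type} (P Q : T -> Prop) := forall x, P x <-> Q x.
Definition strict_subset {T : Type} (P Q : T -> Prop) :=
  subsetP P Q /\ exists x, Q x /\ ~ P x.

Definition is_ideal (I : R -> Prop) :=
  [/\ I 0, (forall x y, I x -> I y -> I (x + y)) & (forall r x, I x -> I (r * x))].

Definition is_prime (P : R -> Prop) :=
  [/\ is_ideal P, ~ P 1 & forall a b, P (a * b) -> P a \/ P b].

Definition is_unit_el (x : R) := exists y, x * y = 1.

Definition local_ring (m : R -> Prop) :=
  [/\ is_ideal m, ~ m 1 & forall x, ~ m x -> is_unit_el x].

Definition noetherian :=
  forall f : nat -> R -> Prop, (forall n, is_ideal (f n)) ->
    (forall n, subsetP (f n) (f n.+1)) ->
    exists N, forall n, (N <= n)%N -> seteqP (f n) (f N).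

Definition prime_chain (p : nat -> R -> Prop) (d : nat) :=
  (forall i, (i <= d)%N -> is_prime (p i)) /\
  (forall i, (i < d)%N -> strict_subset (p i) (p i.+1)).

Definition krull_dim (d : nat) :=
  (exists p, prime_chain p d) /\ ~ (exists p, prime_chain p d.+1).

Definition gen_ideal (s : seq R) (x : R) :=
  exists c : 'I_(size s) -> R, x = \sum_(i < size s) c i * s`_i.

Definition generates (I : R -> Prop) (s : seq R) := seteqP I (gen_ideal s).
Definition mu_eq (I : R -> Prop) (k : nat) :=
  (exists s, size s = k /\ generates I s) /\
  (forall s, generates I s -> (k <= size s)%N).

Definition radical (I : R -> Prop) (x : R) := exists n, I (x ^+ n).
Definition primary_to (m I : R -> Prop) := is_ideal I /\ seteqP (radical I) m.

Definition ideal_pow (I : R -> Prop) (n : nat) (x : R) :=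
  exists k (r : 'I_k -> R) (a : 'I_k -> 'I_n -> R),
    (forall j i, I (a j i)) /\ x = \sum_(j < k) r j * \prod_(i < n) a j i.

(* characteristic: c is the characteristic of R / P (P = kernel), i.e.
   n%:R lies in P iff c divides n *)
Definition char_mod (P : R -> Prop) (c : nat) :=
  P (c%:R) /\ forall n : nat, P (n%:R) -> (c %| n)%N.

Definition equichar (m : R -> Prop) :=
  exists c, char_mod (fun x => x = 0) c /\ char_mod m c.

Variable M : lmodType R.

Definition is_submod (N : M -> Prop) :=
  [/\ N 0, (forall x y, N x -> N y -> N (x + y)) & (forall r x, N x -> N (r *: x))].

Definition ideal_mod (J : R -> Prop) (x : M) :=
  exists k (r : 'I_k -> R) (y : 'I_k -> M),
    (forall j, J (r j)) /\ x = \sum_(j < k) r j *: y j.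

Definition fin_gen_mod :=
  exists s : seq M, forall x, exists c : 'I_(size s) -> R,
    x = \sum_(i < size s) c i *: s`_i.

Definition regular_seq (m : R -> Prop) (s : seq R) :=
  [/\ (forall i, (i < size s)%N -> m s`_i),
      (forall i, (i < size s)%N -> forall y : M,
          ideal_mod (gen_ideal (take i s)) (s`_i *: y) ->
          ideal_mod (gen_ideal (take i s)) y)
    & exists y : M, ~ ideal_mod (gen_ideal s) y].

Definition depth_eq (m : R -> Prop) (r : nat) :=
  (exists s, size s = r /\ regular_seq m s) /\
  (forall s, regular_seq m s -> (size s <= r)%N).

Definition MCM (m : R -> Prop) :=
  fin_gen_mod /\ exists d, krull_dim d /\ depth_eq m d.

Definition submod_chain (N2 N1 : M -> Prop) (f : nat -> M -> Prop) (k : nat) :=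
  [/\ seteqP (f 0%N) N2, seteqP (f k) N1,
      (forall i, (i <= k)%N -> is_submod (f i))
    & (forall i, (i < k)%N -> strict_subset (f i) (f i.+1))].

Definition length_quot (N1 N2 : M -> Prop) (k : nat) :=
  (exists f, submod_chain N2 N1 f k) /\ ~ (exists f, submod_chain N2 N1 f k.+1).

Definition hilbert_fun_is (I : R -> Prop) (h : nat -> nat) :=
  forall n, length_quot (ideal_mod (ideal_pow I n)) (ideal_mod (ideal_pow I n.+1)) (h n).

End CommAlg.

(* Main.v *)
(** By prime avoidance in cosets, [I = (x_1, ..., x_d, y)] with [x_1, ..., x_d] an
    [M]-regular sequence; put [J = (x_1, ..., x_d)] and write [l] for the length.
    Multiplication by [y] maps [I^n M] onto [I^(n+1) M / J^(n+1) M] with kernel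
    [L_n = I^n M cap (J^(n+1) M : y)], whence
    [l(I^n M / I^(n+1) M) = l(M / J^(n+1) M) - l(M / L_n)].
    The increment of the Hilbert function at [n] is therefore
    [l(J^(n+1) M / J^(n+2) M) - l(L_n / L_(n+1))].  Since [J L_n <= L_(n+1)] and
    [J^(n+1) M <= L_n], it is non-negative by the following fact: a submodule [L]
    containing [J^r M] satisfies [l(L / J L) <= l(M / J M) binom(r + d - 1, d - 1)],
    with equality for [L = J^r M]. *)
Require Import Defs.
From mathcomp Require Import all_boot all_order all_algebra.
From mathcomp Require Import boolp zify.

Set Implicit Arguments.
Unset Strict Implicit.
Unset Printing Implicit Defensive.

Import GRing.Theory.
Local Open Scope ring_scope.

(** Noetherian induction: every counterexample has a larger one, and choosing repeatedly gives an
    infinite ascending chain. *)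
Lemma strict_ind (T : Type) (lt : T -> T -> Prop) (P : T -> Prop) :
  (forall f : nat -> T, ~ forall n, lt (f n) (f n.+1)) ->
  (forall x, (forall y, lt x y -> P y) -> P x) -> forall x, P x.
Proof.
move=> acc step x0; apply: contrapT => nx0.
have next (x : {x | ~ P x}) : {y : {x | ~ P x} | lt (sval x) (sval y)}.
  apply: cid; case: x => x nx /=; apply: contrapT => h.
  apply/nx/step => y xy; apply: contrapT => ny.
  by apply: h; exists (exist _ y ny).
pose f n := iter n (fun x => sval (next x)) (exist _ x0 nx0).
by apply: (acc (fun n => sval (f n))) => n; apply: svalP (next (f n)).
Qed.

(** * Prime avoidance *)

Section Primes.
Variable R : comNzRingType.
Implicit Types (I J P : R -> Prop) (ps : seq (R -> Prop)).

Lemma primeX P a n : is_prime P -> P (a ^+ n) -> P a.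
Proof.
case=> _ n1 pM; elim: n => [|n IH]; first by rewrite expr0.
by rewrite exprS => /pM[].
Qed.

Lemma idealB I a b : is_ideal I -> I a -> I b -> I (a - b).
Proof. by case=> _ iD iM ia ib; apply: iD => //; rewrite -mulN1r; apply: iM. Qed.

Lemma ideals_meet_outside P ps : is_prime P ->
  (forall P', List.In P' ps -> exists r, P' r /\ ~ P r) ->
  exists2 r, ~ P r & forall P', List.In P' ps -> is_ideal P' -> P' r.
Proof.
move=> [pI p1 pM]; elim: ps => [|P' ps IH] h; first by exists 1.
have [|r nr rps] := IH; first by move=> P'' i; apply: h; right.
have [|r' [p'r' nr']] := h P'; first by left.
exists (r' * r); first by case/pM.
move=> P'' [<-|i] iP''; have [_ _ iM] := iP''; first by rewrite mulrC; apply: iM.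
by apply: iM; apply: rps.
Qed.

(* Davis' coset version of prime avoidance. *)
Lemma coset_avoidance x J ps : is_ideal J ->
  exists2 j, J j & forall P, List.In P ps -> is_prime P ->
    ~ (P x /\ Defs.subsetP J P) -> ~ P (x + j).
Proof.
move=> iJ; have [J0 JD JM] := iJ.
have [k] := ubnP (size ps); elim: k ps => // k IH [|P ps] szk.
  by exists 0.
have [j Jj javoid] := IH ps szk.
case: (pselect (is_prime P /\ ~ (P x /\ Defs.subsetP J P))) => [[pP nP]|bad]; last first.
  by exists j => // P' [<- ? ?|]; [case: bad | apply: javoid].
case: (pselect (exists2 P', List.In P' ps & Defs.subsetP P' P)) => [[P' inP' P'P]|max].
  have [l1 [l2 eps]] := List.in_split _ _ inP'.
  have [|j' Jj' j'avoid] := IH (P :: l1 ++ l2).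
    move: szk; rewrite eps /= !size_cat /=; lia.
  exists j' => // P'' [<-|]; first by apply: j'avoid; left.
  rewrite eps => inP'' p'' n''.
  case: (List.in_app_or _ _ _ inP'') => [i|[e|i]].
  - by apply: j'avoid => //; right; apply: List.in_or_app; left.
  - by rewrite -e => /P'P; apply: j'avoid => //; left.
  - by apply: j'avoid => //; right; apply: List.in_or_app; right.
case: (pselect (P (x + j))) => [Pxj|]; last first.
  by exists j => // P' [<-|]; [|apply: javoid].
have [pI p1 pM] := pP.
have [r nr rps] : exists2 r, ~ P r & forall P', List.In P' ps -> is_ideal P' -> P' r.
  apply: ideals_meet_outside => // P' inP'; apply: contrapT => h.
  apply: max; exists P' => // r P'r; apply: contrapT => nPr.
  by apply: h; exists r.
have [j' Jj' nPj'] : exists2 j', J j' & ~ P j'.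
  apply: contrapT => h; apply: nP.
  have JP : Defs.subsetP J P by move=> y Jy; apply: contrapT => nPy; apply: h; exists y.
  by split=> //; rewrite -[x](addrK j); apply: idealB => //; apply: JP.
(* The correction [r * j'] moves [x + j] out of [P] and, lying in all the other primes, changes
   nothing modulo them. *)
exists (j + r * j'); first by apply/JD/JM.
move=> P' [<- _ _|inP' pP' nP'] Pz.
  have : P (r * j').
    rewrite -[r * j'](addKr (x + j)) [- _ + _]addrC -[x + j + r * j']addrA.
    exact: idealB.
  by case/pM.
apply: (javoid P' inP' pP' nP'); rewrite -[x + j](addrK (r * j')) -[x + j + _]addrA.
have [iP' _ _] := pP'; have [_ _ iM'] := iP'.
by apply: idealB => //; rewrite mulrC; apply: iM'; apply: rps.
Qed.

Lemma gen_ideal_ideal (s : seq R) : is_ideal (gen_ideal s).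
Proof.
split.
- by exists (fun=> 0); rewrite big1 // => i _; rewrite mul0r.
- move=> _ _ [c ->] [c' ->]; exists (fun i => c i + c' i).
  by rewrite -big_split; apply: eq_bigr => i _; rewrite mulrDl.
- move=> r _ [c ->]; exists (fun i => r * c i).
  by rewrite mulr_sumr; apply: eq_bigr => i _; rewrite mulrA.
Qed.

Lemma mem_gen_ideal (s : seq R) x : x \in s -> gen_ideal s x.
Proof.
move=> xs; have ixs : (index x s < size s)%N by rewrite index_mem.
exists (fun i => (i == Ordinal ixs)%:R).
rewrite (bigD1 (Ordinal ixs)) //= eqxx mul1r nth_index // big1 ?addr0 // => i.
by move/negPf->; rewrite mul0r.
Qed.

Lemma gen_ideal_min (s : seq R) J : is_ideal J -> (forall x, x \in s -> J x) ->
  Defs.subsetP (gen_ideal s) J.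
Proof.
move=> [J0 JD JM] sJ _ [c ->]; apply: big_ind => // i _; apply/JM/sJ/mem_nth.
exact: ltn_ord.
Qed.

Lemma generates_trans I (s t : seq R) : generates I s ->
  (forall x, x \in s -> gen_ideal t x) -> (forall x, x \in t -> gen_ideal s x) ->
  generates I t.
Proof.
move=> Is st ts r; split.
  by move/Is; apply: gen_ideal_min => //; apply: gen_ideal_ideal.
by move=> tr; apply/Is; move: tr; apply: gen_ideal_min => //; apply: gen_ideal_ideal.
Qed.

Lemma generates_mem I (s t : seq R) : s =i t -> generates I s -> generates I t.
Proof.
move=> st gI; apply: generates_trans gI _ _ => x; first by rewrite st => /mem_gen_ideal.
by rewrite -st => /mem_gen_ideal.
Qed.

End Primes.
(** * Submodules and colength *)

Section Submodules.
Variables (R : comNzRingType) (M : lmodType R).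

Record submod := Submod { carrier :> M -> Prop; carrierP : is_submod carrier }.

Implicit Types (A B C L N P Q : submod) (x y z r : R) (u v w : M).

Lemma sub0 A : A 0. Proof. by case: A => ? []. Qed.
Lemma subD A u v : A u -> A v -> A (u + v). Proof. by case: A => ? []/=; auto. Qed.
Lemma subZ A r u : A u -> A (r *: u). Proof. by case: A => ? []/=; auto. Qed.
Lemma subN A u : A u -> A (- u). Proof. by move=> Au; rewrite -scaleN1r; apply: subZ. Qed.
Lemma subB A u v : A u -> A v -> A (u - v).
Proof. by move=> Au Av; apply/subD/subN. Qed.
Lemma subDl A u v : A v -> A (u + v) -> A u.
Proof. by move=> Av Auv; rewrite -[u](addrK v); apply: subB. Qed.
Lemma sub_trans A v u w : A (u - v) -> A (v - w) -> A (u - w).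
Proof. by move=> auv avw; rewrite -[u](subrK v) -addrA; apply: subD. Qed.
Lemma sub_sum A k (f : 'I_k -> M) : (forall i, A (f i)) -> A (\sum_(i < k) f i).
Proof. by move=> Af; apply: big_ind => //; [apply: sub0 | apply: subD]. Qed.

Lemma submod_eq A B : (forall u, A u <-> B u) -> A = B.
Proof.
case: A B => [a ha] [b hb] /= ab.
have e : a = b by apply: funext => u; apply: propext.
by subst b; rewrite (Prop_irrelevance ha hb).
Qed.

Definition sle A B := forall u, A u -> B u.
Notation "A <=s B" := (sle A B) (at level 70, no associativity).
Definition slt A B := A <=s B /\ ~ B <=s A.
Notation "A <s B" := (slt A B) (at level 70, no associativity).

Lemma sle_refl A : A <=s A. Proof. by []. Qed.
Arguments sle_refl A u _ : clear implicits.
Lemma sle_trans B A C : A <=s B -> B <=s C -> A <=s C.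
Proof. by move=> ab bc u /ab/bc. Qed.
Arguments sle_trans B {A C} _ _ u _.
Lemma sle_anti A B : A <=s B -> B <=s A -> A = B.
Proof. by move=> ab ba; apply: submod_eq => u; split; [apply: ab | apply: ba]. Qed.
Lemma sle_eqVlt A B : A <=s B -> A = B \/ A <s B.
Proof.
by move=> ab; case: (pselect (B <=s A)) => ba; [left; apply: sle_anti | right].
Qed.

Definition stop : submod.
Proof. by exists (fun=> True). Defined.

Definition sbot : submod.
Proof.
exists (fun u => u = 0); split=> // [u v -> ->|r u ->]; by rewrite ?addr0 ?scaler0.
Defined.

Definition sadd A B : submod.
Proof.
exists (fun w => exists u v, [/\ A u, B v & w = u + v]); split.
- by exists 0, 0; rewrite addr0; split=> //; apply: sub0.
- move=> _ _ [u1 [v1 [a1 b1 ->]]] [u2 [v2 [a2 b2 ->]]].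
  by exists (u1 + u2), (v1 + v2); rewrite addrACA; split=> //; apply: subD.
- move=> r _ [u [v [a b ->]]].
  by exists (r *: u), (r *: v); rewrite scalerDr; split=> //; apply: subZ.
Defined.
Notation "A +s B" := (sadd A B) (at level 50, left associativity).

Definition scap A B : submod.
Proof.
exists (fun u => A u /\ B u); split.
- by split; apply: sub0.
- by move=> u v [? ?] [? ?]; split; apply: subD.
- by move=> r u [? ?]; split; apply: subZ.
Defined.
Notation "A &s B" := (scap A B) (at level 48, left associativity).

Definition smul x A : submod.
Proof.
exists (fun w => exists2 u, A u & w = x *: u); split.
- by exists 0; rewrite ?scaler0 //; apply: sub0.
- move=> _ _ [u a ->] [v b ->].
  by exists (u + v); rewrite ?scalerDr //; apply: subD.
- move=> r _ [u a ->]; exists (r *: u); first exact: subZ.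
  by rewrite !scalerA mulrC.
Defined.
Notation "x *s A" := (smul x A) (at level 40).

Definition colon A x : submod.
Proof.
exists (fun u => A (x *: u)); split.
- by rewrite scaler0; apply: sub0.
- by move=> u v a b; rewrite scalerDr; apply: subD.
- by move=> r u a; rewrite scalerA mulrC -scalerA; apply: subZ.
Defined.

Definition scyc u : submod.
Proof.
exists (fun w => exists r, w = r *: u); split.
- by exists 0; rewrite scale0r.
- by move=> _ _ [r ->] [s ->]; exists (r + s); rewrite scalerDl.
- by move=> r _ [s ->]; exists (r * s); rewrite scalerA.
Defined.

Lemma saddP A B u : (A +s B) u <-> exists2 v, B v & A (u - v).
Proof.
split=> [[a [b [aa bb ->]]]|[v bv a]]; first by exists b; rewrite ?addrK.
by exists (u - v), v; rewrite subrK.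
Qed.

Lemma sle_top A : A <=s stop. Proof. by []. Qed.
Lemma sle0 A : sbot <=s A. Proof. by move=> _ ->; apply: sub0. Qed.
Lemma sle_addl A B : A <=s A +s B.
Proof. by move=> u a; exists u, 0; rewrite addr0; split=> //; apply: sub0. Qed.
Lemma sle_addr A B : B <=s A +s B.
Proof. by move=> u a; exists 0, u; rewrite add0r; split=> //; apply: sub0. Qed.
Arguments sle_top A u _ : clear implicits.
Arguments sle0 A u _ : clear implicits.
Arguments sle_addl A B u _ : clear implicits.
Arguments sle_addr A B u _ : clear implicits.
Lemma sadd_le A B C : A <=s C -> B <=s C -> A +s B <=s C.
Proof. by move=> ac bc _ [u [v [/ac a /bc b ->]]]; apply: subD. Qed.
Lemma saddC A B : A +s B = B +s A.
Proof.
apply: sle_anti; apply: sadd_le; do [exact: sle_addl | exact: sle_addr].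
Qed.
Lemma sadd_mono A A' B B' : A <=s A' -> B <=s B' -> A +s B <=s A' +s B'.
Proof.
move=> a b; apply: sadd_le; first exact: sle_trans _ a (sle_addl _ _).
exact: sle_trans _ b (sle_addr _ _).
Qed.
Lemma saddA A B C : A +s (B +s C) = A +s B +s C.
Proof.
apply: sle_anti.
- apply: sadd_le; first exact: sle_trans _ (sle_addl _ _) (sle_addl _ _).
  by apply: sadd_mono => //; apply: sle_addr.
- apply: sadd_le; last exact: sle_trans _ (sle_addr _ _) (sle_addr _ _).
  by apply: sadd_mono => //; apply: sle_addl.
Qed.
Lemma saddAC A B C : A +s B +s C = A +s C +s B.
Proof. by rewrite -!saddA (saddC B). Qed.
Lemma sadd_absorb A B : A <=s B -> A +s B = B.
Proof.
by move=> ab; apply: sle_anti; [apply: sadd_le | apply: sle_addr].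
Qed.
Lemma sadd0 A : A +s sbot = A.
Proof. by rewrite saddC sadd_absorb //; apply: sle0. Qed.
Lemma smul_mono x A B : A <=s B -> x *s A <=s x *s B.
Proof. by move=> ab _ [u /ab b ->]; exists u. Qed.
Lemma smul_le x A : x *s A <=s A.
Proof. by move=> _ [u a ->]; apply: subZ. Qed.
Arguments smul_le x A u _ : clear implicits.
Lemma smulI x A u : A u -> (x *s A) (x *: u). Proof. by exists u. Qed.
Lemma smulD x A B : x *s (A +s B) = x *s A +s x *s B.
Proof.
apply: sle_anti.
- move=> _ [_ [u [v [a b ->]]] ->]; exists (x *: u), (x *: v).
  by rewrite scalerDr; split=> //; apply: smulI.
- by apply: sadd_le; apply: smul_mono; [apply: sle_addl | apply: sle_addr].
Qed.
Lemma smulC x y A : x *s (y *s A) = y *s (x *s A).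
Proof.
apply: sle_anti => _ [_ [u a ->] ->]; rewrite scalerA mulrC -scalerA;
  exact/smulI/smulI.
Qed.

(** The product of the ideal generated by [s] with [A], built so that proofs can peel off one
    generator at a time. *)
Fixpoint lmul (s : seq R) A : submod :=
  if s is x :: s' then x *s A +s lmul s' A else sbot.

Lemma lmul_mono s A B : A <=s B -> lmul s A <=s lmul s B.
Proof.
by move=> ab; elim: s => [|x s IH] //=; apply: sadd_mono IH; apply: smul_mono.
Qed.
Lemma lmul_le s A : lmul s A <=s A.
Proof.
by elim: s => [|x s IH] /=; [apply: sle0 | apply: sadd_le IH; apply: smul_le].
Qed.
Lemma lmulD s A B : lmul s (A +s B) = lmul s A +s lmul s B.
Proof.
elim: s => [|x s IH] /=; first by rewrite sadd0.
by rewrite IH smulD !saddA (saddAC (x *s A)).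
Qed.
Lemma lmul_smul s y A : lmul s (y *s A) = y *s lmul s A.
Proof.
elim: s => [|x s IH] /=; last by rewrite IH smulD smulC.
apply: sle_anti; first exact: sle0.
by move=> _ [_ -> ->]; rewrite scaler0.
Qed.
Lemma lmul_cat s t A : lmul (s ++ t) A = lmul s A +s lmul t A.
Proof.
elim: s => [|x s IH] /=; last by rewrite IH saddA.
by rewrite saddC sadd0.
Qed.
Arguments lmul_le s A u _ : clear implicits.
Definition lpow s n : submod := iter n (lmul s) stop.

Lemma lpowS_le s n : lpow s n.+1 <=s lpow s n.
Proof. exact: lmul_le. Qed.
Arguments lpowS_le s n u _ : clear implicits.

(** If neither inclusion were strict, an element [b = a + c] of [B] would have [c = b - a] in
    [B &s C], hence in [A], and so [b] in [A]. *)
Lemma modular_slt A B C : A <s B -> A &s C <s B &s C \/ A +s C <s B +s C.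
Proof.
move=> [ab nba]; case: (pselect (B &s C <=s A &s C)) => h; last first.
  by left; split=> // u [/ab ? ?].
right; split; first exact: sadd_mono ab (sle_refl _).
move=> h2; apply: nba => u bu.
have [a [c [aa cc eu]]] := h2 u (sle_addl _ _ _ bu).
rewrite eu; apply: subD => //.
suff [] : (A &s C) c by [].
apply: h; split=> //; apply: (@subDl _ _ a); first exact: ab.
by rewrite addrC -eu.
Qed.

(** * Chains of submodules, length and colength *)

Inductive chain P : submod -> nat -> Prop :=
| chain0 : chain P P 0
| chainS Q Q' k : Q <s Q' -> chain P Q' k -> chain P Q k.+1.

Lemma chain_le P Q k : chain P Q k -> Q <=s P.
Proof. by elim=> [|{}Q Q' {}k [qq' _] _]; [|apply: sle_trans]. Qed.

Lemma chain_cat P Q N j k : chain Q N j -> chain P Q k -> chain P N (j + k).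
Proof. by move=> c cP; elim: c => [|A B i ab _ IH] //; apply: chainS ab IH. Qed.

(* By the modular law, each step of a chain remains strict in [N] or in [M/N]. *)
Lemma chain_split P Q N k : chain P Q k -> N <=s P ->
  exists a b, [/\ chain N (Q &s N) a, chain P (Q +s N) b & (k <= a + b)%N].
Proof.
move=> c NP; elim: c => [|A B i ab _ [a [b [ca cb ik]]]].
  exists 0, 0; split=> //.
    have -> : P &s N = N.
      by apply: submod_eq => u; split=> [[]|nu] //; split=> //; apply: NP.
    exact: chain0.
  by rewrite saddC sadd_absorb //; exact: chain0.
have capS : A &s N <=s B &s N by move=> u [/(proj1 ab)].
have addS : A +s N <=s B +s N by apply: sadd_mono (proj1 ab) (sle_refl _).
case: (modular_slt N ab) => [lt|lt].
- case: (sle_eqVlt addS) => [->|lt'].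
    by exists a.+1, b; split=> //; apply: chainS lt ca.
  exists a.+1, b.+1; split; [exact: chainS lt ca|exact: chainS lt' cb|].
  by rewrite addSn addnS leqW.
- case: (sle_eqVlt capS) => [->|lt'].
    by exists a, b.+1; split; rewrite ?addnS //; apply: chainS lt cb.
  exists a.+1, b.+1; split; [exact: chainS lt' ca|exact: chainS lt cb|].
  by rewrite addSn addnS leqW.
Qed.

Lemma chain_map (f : submod -> submod) P Q k :
  (forall A B, Q <=s A -> A <s B -> B <=s P -> f A <s f B) ->
  chain P Q k -> chain (f P) (f Q) k.
Proof.
move=> fS c; elim: c fS => [|A B i ab cB IH] fS; first exact: chain0.
apply: chainS (fS A B (sle_refl _) ab (chain_le cB)) (IH _) => C D BC.
by apply: fS; apply: sle_trans _ (proj1 ab) BC.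
Qed.

(* [colen Q] is the length of [M/Q]; it is meaningful only under [fincol Q]. *)
Definition fincol Q := exists k, forall j, chain stop Q j -> (j <= k)%N.

(** Finiteness stands inside the existential so that choice yields a total function. *)
Lemma colen_ex Q : exists k, fincol Q ->
  chain stop Q k /\ forall j, chain stop Q j -> (j <= k)%N.
Proof.
case: (pselect (fincol Q)) => [[k kb]|nf]; last by exists 0.
have ex : exists j, `[< chain stop Q j >].
  case: (sle_eqVlt (sle_top Q)) => [->|lt]; first by exists 0; apply/asboolP/chain0.
  by exists 1; apply/asboolP; apply: chainS lt (chain0 _).
have ub j : `[< chain stop Q j >] -> (j <= k)%N by move/asboolP/kb.
exists (ex_maxn ex ub); case: ex_maxnP => j /asboolP cj jmax _; split=> // i ci.
by apply/jmax/asboolP.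
Qed.

Definition colen Q : nat := projT1 (cid (colen_ex Q)).

Lemma colenP Q : fincol Q ->
  chain stop Q (colen Q) /\ forall j, chain stop Q j -> (j <= colen Q)%N.
Proof. by rewrite /colen; case: cid. Qed.

(** Additivity of length: a longest chain above [Q] splits along [P], and conversely chains below
    and above [P] concatenate. *)
Lemma chain_between Q P : fincol Q -> Q <=s P ->
  [/\ fincol P, (colen P <= colen Q)%N, chain P Q (colen Q - colen P)
    & forall j, chain P Q j -> (j <= colen Q - colen P)%N].
Proof.
move=> fQ QP; have [cQ maxQ] := colenP fQ.
have [a [b [ca cb ab]]] := chain_split cQ (sle_top P).
have eC : Q &s P = Q by apply: submod_eq => u; split=> [[]|q] //; split=> //; apply: QP.
move: ca cb; rewrite eC sadd_absorb // => ca cb.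
have fP : fincol P.
  exists (colen Q) => j cj; apply: leq_trans (maxQ _ (chain_cat ca cj)).
  exact: leq_addl.
have [cP maxP] := colenP fP.
have le_ba := maxP _ cb.
have le_a j : chain P Q j -> (j + colen P <= colen Q)%N.
  by move=> cj; apply/maxQ/(chain_cat cj).
have PQ : (colen P <= colen Q)%N by apply: leq_trans (leq_addl _ _) (le_a _ ca).
have lea j : chain P Q j -> (j <= colen Q - colen P)%N.
  by move/le_a; rewrite leq_subRL // addnC.
split=> //; suff -> : (colen Q - colen P)%N = a by [].
apply/eqP; rewrite eqn_leq lea // andbT leq_subLR addnC.
by apply: leq_trans ab _; rewrite leq_add2l.
Qed.

Lemma fincolS Q P : fincol Q -> Q <=s P -> fincol P.
Proof. by move=> fQ /(chain_between fQ)[]. Qed.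

Lemma colenS Q P : fincol Q -> Q <=s P -> (colen P <= colen Q)%N.
Proof. by move=> fQ /(chain_between fQ)[]. Qed.

Lemma chain_refl P j : chain P P j -> j = 0%N.
Proof.
by move=> c; inversion c as [|Q Q' k [_ h] c']; [|case: h; apply: chain_le c'].
Qed.

Lemma fincol_top : fincol stop.
Proof. by exists 0 => j /chain_refl ->. Qed.

Lemma colen_top : colen stop = 0%N.
Proof. by have [/chain_refl] := colenP fincol_top. Qed.

(* The two differences of colengths are the lengths of the isomorphic modules
   [L / (L :&: (N : x))] and [(x L + N) / N]. *)
Lemma colen_smul x L N : fincol N -> fincol L -> fincol (L &s colon N x) ->
  (colen N + colen L = colen (x *s L +s N) + colen (L &s colon N x))%N.
Proof.
move=> fN fL fC.
have [_ le1 c1 m1] := chain_between fN (sle_addr (x *s L) N).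
have capL : L &s colon N x <=s L by move=> u [].
have [_ le2 c2 m2] := chain_between fC capL.
suff e : (colen N - colen (x *s L +s N) = colen (L &s colon N x) - colen L)%N.
  by have := subnK le1; have := subnK le2; lia.
apply/eqP; rewrite eqn_leq; apply/andP; split.
(* Sending [A] to [L &s colon A x] keeps the steps between [N] and [x *s L +s N] strict; the map
   from [A] to [x *s A +s N] serves in the opposite direction. *)
- apply: m2.
  have := @chain_map (fun A => L &s colon A x) _ _ _ _ c1.
  have -> : L &s colon (x *s L +s N) x = L.
    apply: submod_eq => u; split=> [[]|lu] //; split=> //.
    exact: sle_addl _ _ _ (smulI x lu).
  apply=> A B NA [AB nBA] BP; split=> [u [lu /AB]|h] //.
  apply: nBA => w bw; have [_ [n [[u lu ->] nn ew]]] := BP _ bw.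
  rewrite ew; apply: subD; last exact: NA.
  suff [] : (L &s colon A x) u by [].
  apply: h; split=> //=; apply: (@subDl _ _ n); last by rewrite -ew.
  exact/AB/NA.
- apply: m1.
  have := @chain_map (fun A => x *s A +s N) _ _ _ _ c2.
  have -> : x *s (L &s colon N x) +s N = N.
    by rewrite sadd_absorb // => _ [u [_ nu] ->].
  apply=> A B NA [AB nBA] BP; split.
    exact: sadd_mono (smul_mono AB) (sle_refl _).
  move=> h; apply: nBA => u bu.
  have [_ [n [[v av ->] nn e]]] := h _ (sle_addl _ _ _ (smulI x bu)).
  have : (L &s colon N x) (u - v).
    split; first by apply: subB; apply: BP => //; apply: AB.
    by rewrite /= scalerBr e addrC addKr.
  move=> /NA a; by rewrite -(subrK v u); apply: subD.
Qed.


(** * Associated primes *)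

(** The annihilator of the class of [v] in [M/Q]; when prime, it is an associated prime of [M/Q]. *)
Definition annq Q v : R -> Prop := fun r => Q (r *: v).

Lemma annq_ideal Q v : is_ideal (annq Q v).
Proof.
rewrite /annq; split=> [|a b qa qb|r a qa]; first by rewrite scale0r; apply: sub0.
  by rewrite scalerDl; apply: subD.
by rewrite -scalerA; apply: subZ.
Qed.

Fixpoint span (l : seq M) : submod := if l is u :: l' then scyc u +s span l' else sbot.

Lemma scyc_id u : scyc u u. Proof. by exists 1; rewrite scale1r. Qed.

Lemma mem_span l i : (i < size l)%N -> span l l`_i.
Proof.
elim: l i => [|u l IH] [|i] // il.
  exact: (sle_addl (scyc u) (span l) _ (scyc_id u)).
exact: (sle_addr (scyc u) (span l) _ (IH i il)).
Qed.

Lemma fin_gen_span : fin_gen_mod M -> exists l, span l = stop.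
Proof.
case=> l gl; exists l; apply: sle_anti => // u _; have [c ->] := gl u.
by apply: sub_sum => i; apply/subZ/mem_span.
Qed.

Section Noetherian.
Hypothesis Rnoeth : noetherian R.

Lemma annq_ind Q (P : M -> Prop) :
  (forall v, (forall w, (forall r, annq Q v r -> annq Q w r) ->
     (exists2 r, annq Q w r & ~ annq Q v r) -> P w) -> P v) -> forall v, P v.
Proof.
move=> step; apply: (@strict_ind _ (fun v w => (forall r, annq Q v r -> annq Q w r) /\
   exists2 r, annq Q w r & ~ annq Q v r)).
  move=> f fS; have [N hN] := Rnoeth (fun n => annq_ideal Q (f n))
    (fun n => proj1 (fS n)).
  have [_ [r ar nr]] := fS N; apply: nr.
  exact/(hN N.+1 (leqnSn N)).
by move=> v IH; apply: step => w le lt; apply: IH.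
Qed.

(** An annihilator that is maximal among those missing the multiplicative set [W] is prime. *)
Lemma annq_prime_avoid Q (W : R -> Prop) v :
  W 1 -> (forall a b, W a -> W b -> W (a * b)) ->
  (forall r, W r -> ~ annq Q v r) ->
  exists w, [/\ is_prime (annq Q w), (forall r, W r -> ~ annq Q w r)
    & forall r, annq Q v r -> annq Q w r].
Proof.
move=> W1 WM; elim/(@annq_ind Q): v => v IH Wv.
case: (pselect (exists w, [/\ (forall r, annq Q v r -> annq Q w r),
   (exists2 r, annq Q w r & ~ annq Q v r) & forall r, W r -> ~ annq Q w r])).
  move=> [w [le lt Ww]]; have [w' [p' W' le']] := IH w le lt Ww.
  by exists w'; split=> // r /le/le'.
move=> max; exists v; split=> //; split; [exact: annq_ideal|exact: Wv|] => a b ab.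
case: (pselect (annq Q v b)) => [|nb]; [by right | left].
apply: contrapT => na; apply: max.
(* If [b *: v] is not a larger candidate, some [c] in [W] kills it modulo [Q]; then [c *: v] is one,
   since [b] kills it. *)
case: (pselect (forall r, W r -> ~ annq Q (b *: v) r)) => [Wb|].
  exists (b *: v); split=> //; last by exists a => //; rewrite /annq scalerA.
  by move=> r; rewrite /annq scalerA mulrC -scalerA; apply: subZ.
move=> /existsNP[c /not_implyP[Wc /contrapT cb]].
exists (c *: v); split.
- by move=> r; rewrite /annq scalerA mulrC -scalerA; apply: subZ.
- by exists b => //; move: cb; rewrite /annq !scalerA mulrC.
- by move=> r Wr; rewrite /annq scalerA; apply/Wv/WM.
Qed.

Lemma annq_prime_above Q v : ~ Q v ->
  exists w, [/\ is_prime (annq Q w), ~ Q w & forall r, annq Q v r -> annq Q w r].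
Proof.
move=> nv; have [|||w [pw w1 le]] := @annq_prime_avoid Q (fun r => r = 1) v.
- by [].
- by move=> a b -> ->; rewrite mulr1.
- by move=> r ->; rewrite /annq scale1r.
- by exists w; split=> //; have := w1 1 erefl; rewrite /annq scale1r.
Qed.

Hypothesis Mfg : fin_gen_mod M.

(** * Ascending chain condition and finiteness of the associated primes *)

Lemma chain_leq (f : nat -> submod) : (forall n, f n <=s f n.+1) ->
  forall i j, (i <= j)%N -> f i <=s f j.
Proof.
move=> fS i j /subnK <-; elim: (j - i)%N => [|k IH] //.
exact: sle_trans _ IH (fS _).
Qed.

(** Induction on the generators of [M]: the coefficients of the first one form ideals that
    stabilise, and elements with equal first coefficient differ by a combination of the others. *)
Lemma submod_acc (f : nat -> submod) : (forall n, f n <=s f n.+1) ->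
  exists N : nat, forall n, f n <=s f N.
Proof.
move=> fS; have fle := chain_leq fS; have [l el] := fin_gen_span Mfg.
suff [N hN] : exists N : nat, forall n, f n &s span l <=s f N.
  by exists N => n u fu; apply: (hN n); split=> //; rewrite el.
elim: l {el} => [|e l [N2 IH]].
  by exists 0 => n u [_ ->]; apply: sub0.
pose I n r := exists2 v, span l v & f n (r *: e + v).
have II n : is_ideal (I n).
  split.
  - by exists 0; rewrite ?scale0r ?addr0; apply: sub0.
  - move=> a b [v lv av] [w lw bw]; exists (v + w); first exact: subD.
    by rewrite scalerDl addrACA; apply: subD.
  - move=> r a [v lv av]; exists (r *: v); first exact: subZ.
    by rewrite -scalerA -scalerDr; apply: subZ.
have IS n : Defs.subsetP (I n) (I n.+1).
  by move=> r [v lv fv]; exists v => //; apply: fS.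
have [N1 hN1] := Rnoeth II IS.
exists (maxn N1 N2) => n u [fu [_ [v [[r ->] lv eu]]]].
have [w lw fw] : I N1 r.
  have : I (maxn n N1) r by exists v => //; rewrite -eu; apply: fle fu; apply: leq_maxl.
  by move/(hN1 _ (leq_maxr _ _)).
have fw' k : f (maxn k N1) (r *: e + w) by apply: fle fw; apply: leq_maxr.
rewrite -(subrK (r *: e + w) u); apply: subD; last by rewrite maxnC; apply: fw'.
apply: (fle N2); first exact: leq_maxr.
apply: (IH (maxn n N1)); split.
  by apply: subB (fw' n); apply: fle fu; apply: leq_maxl.
by rewrite eu opprD addrACA subrr add0r; apply: subB.
Qed.

Lemma submod_ind (P : submod -> Prop) :
  (forall Q, (forall Q', Q <s Q' -> P Q') -> P Q) -> forall Q, P Q.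
Proof.
apply: strict_ind => f fS.
have [N hN] := submod_acc (fun n => proj1 (fS n)).
by have [_] := fS N; apply; apply: hN.
Qed.

Lemma slt_scyc Q w : ~ Q w -> Q <s Q +s scyc w.
Proof.
by move=> nw; split; [apply: sle_addl | move=> /(_ w (sle_addr _ _ _ (scyc_id w)))].
Qed.

Lemma annq_primes_finite Q : exists ps : seq (R -> Prop),
  forall v, is_prime (annq Q v) -> List.In (annq Q v) ps.
Proof.
elim/submod_ind: Q => Q IH.
case: (pselect (exists u, ~ Q u)) => [[u /annq_prime_above[w [pw nw _]]]|all]; last first.
  exists [::] => v [_ n1 _]; case: n1; rewrite /annq scale1r.
  by apply: contrapT => nv; apply: all; exists v.
have [ps hps] := IH _ (slt_scyc nw).
exists (annq Q w :: ps) => v pv.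
(* If [R v] and [R w] share a nonzero class modulo [Q], both primes are its annihilator; otherwise
   [v] keeps its annihilator modulo [Q +s scyc w]. *)
case: (pselect (exists2 r, (Q +s scyc w) (r *: v) & ~ Q (r *: v))).
  move=> [r /saddP[_ [s ->] q] nr]; left.
  have ns : ~ Q (s *: w).
    by move=> qs; apply: nr; rewrite -(subrK (s *: w) (r *: v)); apply: subD.
  apply: funext => a; apply: propext.
  have ars : Q (a *: (r *: v)) <-> Q (a *: (s *: w)).
    have qa : Q (a *: (r *: v) - a *: (s *: w)) by rewrite -scalerBr; apply: subZ.
    split=> h; last by rewrite -(subrK (a *: (s *: w)) (a *: _)); apply: subD.
    by rewrite -[a *: (s *: w)](subKr (a *: (r *: v))); apply: subB.
  have prim t v' : is_prime (annq Q v') -> ~ Q (t *: v') ->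
      Q (a *: (t *: v')) <-> annq Q v' a.
    case=> _ _ pM nt; rewrite scalerA; split=> [/pM[]|av] //.
    by rewrite mulrC -scalerA; apply: subZ.
  by rewrite -(prim s w) // -ars (prim r v).
move=> h; right; suff e : annq Q v = annq (Q +s scyc w) v.
  by rewrite e; apply: hps; rewrite -e.
apply: funext => r; apply: propext; split; first exact: sle_addl.
by move=> q'; apply: contrapT => nq; apply: h; exists r.
Qed.


(** * Powers of an ideal with one more generator *)

Lemma lmul_le_cons x s A : lmul s A <=s lmul (x :: s) A.
Proof. exact: sle_addr. Qed.
Arguments lmul_le_cons x s A u _ : clear implicits.

Lemma lpow_le_cons x s n : lpow s n <=s lpow (x :: s) n.
Proof.
elim: n => [|n IH]; first exact: sle_refl.
exact: sle_trans _ (lmul_mono IH) (lmul_le_cons x s _).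
Qed.
Arguments lpow_le_cons x s n u _ : clear implicits.

(** A product of [n.+1] generators either has [x] as a factor or involves [s] alone. *)
Lemma lpow_cons x s n : lpow (x :: s) n.+1 = x *s lpow (x :: s) n +s lpow s n.+1.
Proof.
apply: sle_anti; last first.
  by apply: sadd_le; [apply: sle_addl | apply: lpow_le_cons].
elim: n => [|n IH] //.
rewrite [X in X <=s _]/= -!/(lpow _ _); apply: sadd_le; first exact: sle_addl.
apply: sle_trans _ (lmul_mono IH) _.
rewrite lmulD lmul_smul; apply: sadd_mono; last exact: sle_refl.
exact: smul_mono (lmul_le_cons _ _ _).
Qed.

Lemma lpow_add_top x s n : lpow (x :: s) n +s x *s stop = lpow s n +s x *s stop.
Proof.
apply: sle_anti; last by apply: sadd_mono; [apply: lpow_le_cons | apply: sle_refl].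
apply: sadd_le; last exact: sle_addr.
case: n => [|n]; first exact: sle_addl.
rewrite lpow_cons saddC; apply: sadd_mono; first exact: sle_refl.
exact: smul_mono (sle_top _).
Qed.

(** * Regular sequences and powers of the ideal they generate *)

Definition reg x Q := forall u, Q (x *: u) -> Q u.

(* Every element is regular modulo every subset of the earlier ones: this makes
   the sequence permutable without using that the ring is local. *)
Fixpoint sreg s Q : Prop :=
  if s is x :: s' then [/\ reg x Q, sreg s' Q & sreg s' (Q +s x *s stop)]
  else True.

(** From [x u = z v] modulo [Q], regularity of [z] modulo [x] gives [v = x w], and cancelling [x]
    gives [u = z w]. *)
Lemma reg_swap x z Q :
  reg x Q -> reg z (Q +s x *s stop) -> reg x (Q +s z *s stop).
Proof.
move=> rx rz u /saddP[_ [v _ ->] qxz].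
have /saddP[_ [w _ ->] qv] : (Q +s x *s stop) v.
  apply: rz; apply/saddP; exists (x *: u); first exact: smulI.
  by rewrite -opprB; apply: subN.
apply/saddP; exists (z *: w); first exact: smulI.
apply: rx; rewrite scalerBr scalerA mulrC -scalerA.
by apply: (sub_trans qxz); rewrite -scalerBr; apply: subZ.
Qed.

(** Double induction: the shorter sequence reduces [u] to some [y v], and [v] is then treated with
    the exponent lowered by one. *)
Lemma reg_lpow s x Q n : sreg (x :: s) Q -> reg x (Q +s lpow s n).
Proof.
elim: s x Q n => [|y s IHs] x Q n.
  case=> rx _ _; case: n => [|n]; last by rewrite sadd0.
  by move=> u _; apply: sle_addr.
case=> rx [ry s1 s2] [ry' s3 s4].
have IHx k : reg x (Q +s y *s stop +s lpow s k).
  by apply: IHs; split=> //; [apply: reg_swap | rewrite saddAC].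
have IHy k : reg y (Q +s lpow s k) by apply: IHs.
elim: n => [|n IHn] u; first by move=> _; apply: sle_addr.
rewrite lpow_cons (saddC (y *s _)) saddA => /saddP[_ [b pb ->] exu].
have /saddP[_ [v _ ->] eu] : (Q +s lpow s n.+1 +s y *s stop) u.
  rewrite saddAC; apply: IHx; rewrite saddAC.
  by apply/saddP; exists (y *: b) => //; apply: smulI.
have QP : Q +s lpow s n.+1 <=s Q +s lpow (y :: s) n.
  apply: sadd_mono; first exact: sle_refl.
  exact: sle_trans _ (lpow_le_cons y s _) (lpowS_le _ _).
have /saddP[p pp qvp] : (Q +s lpow (y :: s) n) v.
  apply: IHn; suff : (Q +s lpow s n.+1) (x *: v - b).
    by move/QP; apply: subDl; apply/subN/sle_addr.
  apply: IHy; rewrite scalerBr scalerA mulrC -scalerA.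
  apply: (@sub_trans _ (x *: u)); last by [].
  by rewrite -scalerBr -opprB scalerN; apply/subN/subZ.
apply/saddP; exists (y *: p); first exact: smulI.
apply: (sub_trans eu); rewrite -scalerBr.
exact/subZ/sle_addl.
Qed.

(** Splitting off the multiples of [x] with [lpow_cons] leaves [x (u - v)] in [Q +s lpow s n.+1],
    where [reg_lpow] cancels [x]. *)
Lemma sreg_colon s x Q n : sreg (x :: s) Q ->
  colon (Q +s lpow (x :: s) n.+1) x = Q +s lpow (x :: s) n.
Proof.
move=> rxs; have rx := @reg_lpow s x Q n.+1 rxs.
apply: sle_anti => u.
  move=> uP; have {uP} : (Q +s lpow (x :: s) n.+1) (x *: u) := uP.
  rewrite lpow_cons (saddC (x *s _)) saddA => /saddP[_ [v pv ->]].
  rewrite -scalerBr => /rx uv; rewrite -(subrK v u).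
  apply: subD; last exact: sle_addr.
  move: uv; apply: sadd_mono; first exact: sle_refl.
  exact: sle_trans _ (lpow_le_cons x s _) (lpowS_le _ _).
move=> /saddP[p pp qup]; suff : (Q +s lpow (x :: s) n.+1) (x *: u) by [].
apply/saddP; exists (x *: p).
  by rewrite lpow_cons; apply/sle_addl/smulI.
by rewrite -scalerBr; apply: subZ.
Qed.

Lemma colen_colon x T : fincol T ->
  colen T = (colen (T +s x *s stop) + colen (colon T x))%N.
Proof.
move=> fT; have TC : T <=s colon T x by move=> u; apply: subZ.
have e : stop &s colon T x = colon T x by apply: submod_eq => u; split=> [[]|].
have := @colen_smul x stop T fT fincol_top.
rewrite e colen_top addn0 saddC; apply; exact: fincolS TC.
Qed.

Lemma fincol_lpow_cons x s Q n :
  fincol (Q +s lpow (x :: s) n) -> fincol (Q +s x *s stop +s lpow s n).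
Proof.
move=> f; apply: fincolS f _; rewrite -saddA; apply: sadd_mono.
  exact: sle_refl.
by rewrite saddC -lpow_add_top; apply: sle_addl.
Qed.

Lemma fincol_lpowS s Q n :
  fincol (Q +s lpow s n.+1) -> fincol (Q +s lpow s n).
Proof.
move=> f; apply: fincolS f _; apply: sadd_mono (lpowS_le _ _).
exact: sle_refl.
Qed.

Lemma pascal n k : 'C(n.+1 + k.+1, k.+1) = ('C(n + k.+1, k.+1) + 'C(n.+1 + k, k))%N.
Proof. by rewrite addSn binS addnS -addSn. Qed.

(* Both inequalities below come from [l(M/T) = l(M/(T + xM)) + l(M/(T : x))]:
   the two terms are handled by induction on the sequence and on [n]
   respectively, in accordance with Pascal's rule. *)
Lemma colen_lmul_le x s Q L n : Q <=s L -> lpow (x :: s) n <=s L ->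
  fincol (Q +s lpow (x :: s) n.+1) ->
  (colen (Q +s lmul (x :: s) L) <=
   colen L + colen (Q +s lmul (x :: s) stop) * 'C(n + size s, size s))%N.
Proof.
elim: s x Q L n => [|y s IHs] x Q L n QL PL f.
  have fT : fincol (Q +s x *s L).
    apply: fincolS f _; apply: sadd_mono; first exact: sle_refl.
    by rewrite /= sadd0; apply: smul_mono.
  rewrite /= !sadd0 bin0 muln1 (colen_colon x fT) addnC leq_add //.
  - apply: colenS; last by move=> u lu; apply: sle_addr Q _ _ (smulI x lu).
    by apply: fincolS fT _; apply: sadd_le (smul_le _ _).
  - apply: colenS; last by apply: sadd_mono (sle_addl _ _) (sle_refl _).
    by apply: fincolS fT _; apply: sadd_mono (sle_refl _) (smul_mono (sle_top _)).
have fL : fincol L.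
  by apply: fincolS (fincol_lpowS f) _; apply: sadd_le.
elim: n L QL PL f fL => [|n IHn] L QL PL f fL.
  have -> : L = stop by apply: sle_anti PL => u.
  by rewrite binn muln1 leq_addl.
have fT : fincol (Q +s lmul (x :: y :: s) L).
  by apply: fincolS f _; apply: sadd_mono (sle_refl _) (lmul_mono PL).
have QLx : Q <=s colon L x by move=> u /QL; apply: subZ.
have PLx : lpow (x :: y :: s) n <=s colon L x.
  by move=> u pu; apply: PL; rewrite lpow_cons; apply/sle_addl/smulI.
have fn := fincol_lpowS f.
have fLx : fincol (colon L x) by apply: fincolS fL _ => u; apply: subZ.
have PL1 : lpow (y :: s) n.+1 <=s L +s x *s stop.
  apply: sle_trans _ (lpow_le_cons x _ _) _.
  exact: sle_trans _ PL (sle_addl _ _).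
have fx := fincol_lpow_cons f.
have QL1 : Q +s x *s stop <=s L +s x *s stop by apply: sadd_mono QL (sle_refl _).
(* The colon term keeps the sequence and lowers the exponent; the term modulo [x] keeps the
   exponent, shortens the sequence and absorbs [x *s stop] into [Q]. *)
have := IHn _ QLx PLx fn fLx.
have := IHs y (Q +s x *s stop) (L +s x *s stop) n.+1 QL1 PL1 fx.
move=> IH1 IH2.
rewrite (colen_colon x fT) (colen_colon x fL).
have le1 : Q +s x *s stop +s lmul (y :: s) (L +s x *s stop)
    <=s Q +s lmul (x :: y :: s) L +s x *s stop.
  rewrite lmulD lmul_smul; apply: sadd_le.
    by apply: sadd_mono (sle_addl _ _) (sle_refl _).
  apply: sadd_mono; last exact: smul_mono (sle_top _).
  exact: sle_trans _ (lmul_le_cons x _ _) (sle_addr _ _).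
have le2 : Q +s lmul (x :: y :: s) (colon L x)
    <=s colon (Q +s lmul (x :: y :: s) L) x.
  move=> u /saddP[v lv quv].
  suff : (Q +s lmul (x :: y :: s) L) (x *: u) by [].
  apply/saddP; exists (x *: v); last by rewrite -scalerBr; apply: subZ.
  have : (lmul (x :: y :: s) (x *s colon L x)) (x *: v).
    by rewrite lmul_smul; apply: smulI.
  by apply: lmul_mono => _ [w lw ->].
have /colenS/(_ le1) c1 : fincol (Q +s x *s stop +s lmul (y :: s) (L +s x *s stop)).
  by apply: fincolS fx _; apply: sadd_mono (sle_refl _) (lmul_mono PL1).
have /colenS/(_ le2) c2 : fincol (Q +s lmul (x :: y :: s) (colon L x)).
  by apply: fincolS fn _; apply: sadd_mono (sle_refl _) (lmul_mono PLx).
have := leq_add (leq_trans c1 IH1) (leq_trans c2 IH2).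
rewrite [size (y :: s)]/= pascal mulnDr -(saddA Q _ (lmul _ stop)).
by rewrite -/(lmul (x :: y :: s) stop); lia.
Qed.

Lemma colen_lpow_ge x s Q n : sreg (x :: s) Q ->
  fincol (Q +s lpow (x :: s) n.+1) ->
  (colen (Q +s lpow (x :: s) n) +
   colen (Q +s lmul (x :: s) stop) * 'C(n + size s, size s) <=
   colen (Q +s lpow (x :: s) n.+1))%N.
Proof.
elim: s x Q n => [|y s IHs] x Q n rxs f.
  rewrite (colen_colon x f) sreg_colon // bin0 muln1 addnC leq_add2r.
  apply: colenS; first by apply: fincolS f (sle_addl _ _).
  rewrite -saddA lpow_add_top [lmul _ _]/= sadd0.
  by apply: sadd_mono (sle_refl _) _; apply: sadd_le _ (sle_refl _); apply: sle0.
elim: n f => [|n IHn] f.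
  have -> : Q +s lpow (x :: y :: s) 0 = stop.
    by apply: sle_anti => // u _; apply: sle_addr.
  by rewrite colen_top binn muln1.
have fn := fincol_lpowS f.
have := IHn fn.
have [_ _ sx] := rxs.
have := IHs y (Q +s x *s stop) n.+1 sx (fincol_lpow_cons f).
have := colen_colon x f; have := colen_colon x fn; rewrite !sreg_colon //.
have addx k : Q +s lpow (x :: y :: s) k +s x *s stop
    = Q +s x *s stop +s lpow (y :: s) k.
  by rewrite -saddA lpow_add_top saddA saddAC.
rewrite !addx -(saddA Q _ (lmul _ stop)) -/(lmul (x :: y :: s) stop).
by rewrite [size (y :: s)]/= pascal mulnDr; lia.
Qed.

(* Here [I^(n+1) M = y I^n M + J^(n+1) M] gives
   [l(I^n M / I^(n+1) M) + l(M / L n) = l(M / J^(n+1) M)]. *)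
Lemma hilbert_nondecreasing x s y n : sreg (x :: s) sbot ->
  (forall k, fincol (lpow (x :: s) k)) ->
  (colen (lpow (y :: x :: s) n.+1) - colen (lpow (y :: x :: s) n) <=
   colen (lpow (y :: x :: s) n.+2) - colen (lpow (y :: x :: s) n.+1))%N.
Proof.
move=> rxs fJ; set J := lpow (x :: s) in fJ *; set P := lpow (y :: x :: s).
have JP k : J k <=s P k by apply: lpow_le_cons.
have fP k : fincol (P k) by apply: fincolS (JP k).
pose L k := P k &s colon (J k.+1) y.
have JL k : J k.+1 <=s L k.
  move=> u ju; split; first by apply/JP/lpowS_le.
  exact: subZ.
have fL k : fincol (L k) by apply: fincolS (JL k).
have eL k : (colen (J k.+1) + colen (P k) = colen (P k.+1) + colen (L k))%N.
  by rewrite /P lpow_cons; apply: colen_smul (fJ _) (fP _) (fL _).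
have JLL : lmul (x :: s) (L n) <=s L n.+1.
  move=> u lu; split; first by apply/lmul_le_cons; move: lu; apply: lmul_mono => v [].
  suff : J n.+2 (y *: u) by [].
  have : (lmul (x :: s) (y *s L n)) (y *: u) by rewrite lmul_smul; apply: smulI.
  by apply: lmul_mono => _ [v [_ ?] ->].
have s0 A : sbot +s A = A by rewrite saddC sadd0.
have f0 k : fincol (sbot +s J k) by rewrite s0.
(* With exponent [n.+1] in both, the upper and the lower bound carry the same binomial term, which
   cancels. *)
have up := @colen_lmul_le x s sbot (L n) n.+1 (sle0 _) (JL n) (f0 n.+2).
have lo := @colen_lpow_ge x s sbot n.+1 rxs (f0 n.+2).
have fJL : fincol (lmul (x :: s) (L n)) := fincolS (fJ n.+2) (lmul_mono (JL n)).
have := colenS fJL JLL.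
move: up lo (eL n) (eL n.+1); rewrite !s0 -/J => up lo e1 e2 ?.
by lia.
Qed.

(** * Depth and dimension *)

Variable m : R -> Prop.
Hypothesis locR : local_ring m.

Lemma maximal_prime : is_prime m.
Proof.
have [mI m1 munit] := locR; split=> // a b mab.
case: (pselect (m a)) => [|/munit[c ac]]; [by left | right].
by have [_ _ mM] := mI; rewrite -[b]mul1r -ac mulrAC [_ * c]mulrC; apply: mM.
Qed.

Lemma prime_le_maximal (P : R -> Prop) : is_prime P -> Defs.subsetP P m.
Proof.
move=> [[_ _ PM] P1 _] r Pr; have [_ _ munit] := locR.
apply: contrapT => /munit[c rc]; apply: P1.
by rewrite -rc mulrC; apply: PM.
Qed.

(* Equivalent, by prime avoidance, to [m] containing a regular element on [M/Q]. *)
Definition socle_free Q := forall u, (forall r, m r -> Q (r *: u)) -> Q u.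

(** A non-regular element on [M/Q] lies in one of finitely many associated primes; [socle_free]
    keeps these from containing [m], so [coset_avoidance] applies to all of them at once. *)
Lemma reg_in_coset x J (Qs : seq submod) : is_ideal J ->
  (forall P : R -> Prop, is_prime P -> P x -> Defs.subsetP J P -> Defs.subsetP m P) ->
  (forall Q, List.In Q Qs -> socle_free Q) ->
  exists2 j, J j & forall Q, List.In Q Qs -> reg (x + j) Q.
Proof.
move=> iJ mP sf.
have [ps hps] : exists ps : seq (R -> Prop), forall Q, List.In Q Qs ->
    forall v, is_prime (annq Q v) -> List.In (annq Q v) ps.
  elim: Qs {sf} => [|Q Qs [ps hps]]; first by exists [::].
  have [ps' hps'] := annq_primes_finite Q.
  exists (ps' ++ ps) => Q' [<-|iQ'] v pv; apply: List.in_or_app.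
    by left; apply: hps'.
  by right; apply: hps.
have [j Jj avoid] := coset_avoidance x ps iJ.
exists j => // Q iQ u qu; apply: contrapT => /annq_prime_above[w [pw nw le]].
apply: (avoid _ (hps Q iQ w pw) pw); last exact: le _ qu.
by case=> Px JP; apply: nw; apply: (sf Q iQ) => r mr; exact: mP pw Px JP r mr.
Qed.

(** Only the successive regular elements are recorded, not that the last quotient is nonzero. *)
Fixpoint depth_ge t Q : Prop :=
  if t is t'.+1 then exists x, [/\ m x, reg x Q & depth_ge t' (Q +s x *s stop)]
  else True.

Lemma depth_geS t Q : depth_ge t.+1 Q -> depth_ge t Q.
Proof.
elim: t Q => // t IH Q [x [mx rx dx]].
by exists x; split=> //; apply: IH.
Qed.

Lemma depth_ge_socle_free t Q : depth_ge t.+1 Q -> socle_free Q.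
Proof. by case=> x [mx rx _] u hu; apply/rx/hu. Qed.

(** The relation [x u = y v] modulo [Q] carries a socle class [u] modulo [y] to a socle class [v]
    modulo [x]; the latter vanishes, and [v = x w] gives [u = y w]. *)
Lemma socle_free_swap x y Q : m x -> reg x Q -> reg y Q ->
  socle_free (Q +s x *s stop) -> socle_free (Q +s y *s stop).
Proof.
move=> mx rx ry sf u mu.
have /saddP[_ [v _ ->] xyv] := mu x mx.
have /saddP[_ [w _ ->] vw] : (Q +s x *s stop) v.
  apply: sf => r mr; have /saddP[_ [w _ ->] ruw] := mu r mr.
  apply/saddP; exists (x *: w); first exact: smulI.
  apply: ry; rewrite scalerBr [y *: (r *: v)]scalerA mulrC -scalerA.
  apply: (@sub_trans _ (r *: (x *: u))).
    by rewrite -scalerBr -opprB scalerN; apply/subN/subZ.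
  rewrite [r *: _]scalerA mulrC -scalerA [y *: _]scalerA [y * x]mulrC -scalerA -scalerBr.
  exact: subZ.
apply/saddP; exists (y *: w); first exact: smulI.
apply: rx; rewrite scalerBr scalerA mulrC -scalerA.
by apply: (sub_trans xyv); rewrite -scalerBr; apply: subZ.
Qed.

Lemma maximal_ideal : is_ideal m. Proof. by case: locR. Qed.

(* Kaplansky: compare [x] and [y] through a common [z] regular on both quotients. *)
Lemma depth_ge_quot t Q y : depth_ge t.+1 Q -> m y -> reg y Q ->
  depth_ge t (Q +s y *s stop).
Proof.
elim: t Q y => [|t IH] Q y [x [mx rx dx]] my ry; first by [].
have sfx := depth_ge_socle_free dx.
have sfy := socle_free_swap mx rx ry sfx.
have [||z mz rz] := @reg_in_coset 0 m [:: Q +s x *s stop; Q +s y *s stop] maximal_ideal.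
- by [].
- by move=> Q' [<-|[<-|]].
rewrite add0r in rz.
have rzx : reg z (Q +s x *s stop) by apply: rz; left.
have rzy : reg z (Q +s y *s stop) by apply: rz; right; left.
(* Induction is used twice: for [y] modulo [z], and, to supply its depth hypothesis, for [z] modulo
   [x]. *)
exists z; split=> //; rewrite saddAC; apply: (IH) => //; last exact: reg_swap.
exists x; split=> //; first exact: reg_swap.
by rewrite saddAC; apply: IH.
Qed.

(* Replacing a generator by an element of its coset modulo all the other
   generators keeps the ideal, and some element of this coset avoids finitely many
   given primes other than [m], even when the residue field is finite. *)
Lemma sreg_generators (I : R -> Prop) t (Qs : seq submod) (B a : seq R) :
  primary_to m I -> size a = t.+1 -> generates I (B ++ a) ->
  (forall Q, List.In Q Qs -> depth_ge t Q) ->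
  exists bs y, [/\ size bs = t, generates I (y :: B ++ bs)
    & forall Q, List.In Q Qs -> sreg bs Q].
Proof.
(* [B] holds the generators already replaced, [a] those still to treat; the last one left becomes
   [y]. *)
move=> [II radI]; elim: t Qs B a => [|t IH] Qs B a.
  case: a => [|y []] //= _ gI _; exists [::], y; split=> //.
  by apply: generates_mem gI => z; rewrite cats0 mem_cat !inE orbC.
case: a => [|a1 a] //= [sza] gI dQ.
have mP (P : R -> Prop) : is_prime P -> P a1 -> Defs.subsetP (gen_ideal (B ++ a)) P ->
    Defs.subsetP m P.
  move=> pP Pa1 BaP r /radI[n /gI Irn]; apply: (primeX pP (n := n)).
  move: Irn; apply: gen_ideal_min; first by case: pP.
  move=> z; rewrite mem_cat inE orbCA => /orP[/eqP->//|za].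
  by apply/BaP/mem_gen_ideal; rewrite mem_cat.
have [|j Jj regj] := reg_in_coset (gen_ideal_ideal (B ++ a)) mP (Qs := Qs).
  by move=> Q /dQ/depth_ge_socle_free.
set b := a1 + j in regj.
have gI' : generates I ((b :: B) ++ a).
  have sub (z : R) (s s' : seq R) : {subset s <= s'} -> gen_ideal s z -> gen_ideal s' z.
    move=> ss; apply: gen_ideal_min; first exact: gen_ideal_ideal.
    by move=> w /ss; apply: mem_gen_ideal.
  apply: generates_trans gI _ _ => z.
    rewrite mem_cat inE orbCA => /orP[/eqP->|za]; last first.
      by apply: mem_gen_ideal; rewrite /= inE mem_cat za orbT.
    rewrite -[a1](addrK j); apply: idealB; first exact: gen_ideal_ideal.
      by apply: mem_gen_ideal; rewrite /= inE eqxx.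
    by apply: sub Jj => w; rewrite /= inE => ->; rewrite orbT.
  rewrite /= inE => /orP[/eqP->|za]; last first.
    by apply: mem_gen_ideal; move: za; rewrite !mem_cat inE => /orP[]->; rewrite ?orbT.
  have [_ gD _] := gen_ideal_ideal (B ++ a1 :: a); apply: gD.
    by apply: mem_gen_ideal; rewrite mem_cat inE eqxx orbT.
  by apply: sub Jj => w; rewrite !mem_cat inE => /orP[]->; rewrite ?orbT.
have mb : m b.
  by apply/radI; exists 1%N; rewrite expr1; apply/gI'/mem_gen_ideal; rewrite /= inE eqxx.
(* The list of submodules doubles because [sreg (b :: bs) Q] asks for [sreg bs] both on [Q] and
   modulo [b]. *)
have [|bs [y [szb gy sb]]] :=
    IH (Qs ++ map (fun Q => Q +s b *s stop) Qs) (b :: B) a sza gI'.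
  move=> Q' iQ'; case: (List.in_app_or _ _ _ iQ') => [/dQ/depth_geS //|].
  move=> /(List.in_map_iff (fun Q => Q +s b *s stop))[Q [<- iQ]].
  by apply: depth_ge_quot (dQ Q iQ) mb (regj Q iQ).
exists (b :: bs), y; split; first by rewrite /= szb.
  apply: generates_mem gy => z.
  by rewrite !(inE, mem_cat); congr (_ || _); rewrite orbCA.
move=> Q iQ; split; first exact: regj.
  by apply: sb; apply: List.in_or_app; left.
apply: sb; apply: List.in_or_app; right.
exact: (List.in_map (fun Q => Q +s b *s stop)).
Qed.

(* A regular element lies outside the associated primes, so each element of the
   sequence contributes one more step at the bottom of the chain. *)
Lemma prime_descent s Q (P : R -> Prop) u : sreg s Q -> is_prime P ->
  ~ Defs.subsetP m P -> (forall r, (Q +s lmul s stop) (r *: u) -> P r) ->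
  exists p, prime_chain p (size s).+1 /\
    exists v, forall r, Q (r *: v) -> p 0%N r.
Proof.
move=> + pP nmP; elim: s Q => [|x s IH] Q.
  have -> : Q +s lmul [::] stop = Q by apply: sadd0.
  move=> _ Pu; exists (fun i => if i is 0 then P else m); split; last by exists u.
  split=> [[|i] _|[|i]] //; first exact: maximal_prime.
  move=> _; split; first exact: prime_le_maximal.
  apply: contrapT => h; apply: nmP => r mr; apply: contrapT => nr.
  by apply: h; exists r.
have -> : Q +s lmul (x :: s) stop = Q +s x *s stop +s lmul s stop by apply: saddA.
case=> rx _ sx /(IH _ sx) [p [[pp ps] [v pv]]].
have p0 := pp 0%N isT; have [_ p01 p0M] := p0.
(* Avoiding the complement of [p 0] yields an associated prime inside [p 0]; the inclusion is strict
   because [x] lies in [p 0] but is regular on [M/Q]. *)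
have [||r nr|w [pw nw _]] := @annq_prime_avoid Q (fun r => ~ p 0%N r) v.
- by [].
- by move=> a b na nb /p0M[].
- by move=> qr; apply/nr/pv/sle_addl.
exists (fun i => if i is i'.+1 then p i' else annq Q w); split; last first.
  by exists w.
split=> [[|i]|[|i]] //; [exact: pp| |exact: ps].
move=> _; split; first by move=> r qr; apply: contrapT => /nw.
exists x; split; first by apply/pv/sle_addr/smulI.
by move=> /rx qw; have [_ + _] := pw; rewrite /annq scale1r.
Qed.

(** Modulo [Q], the class of [w] spans a quotient of the residue field, which adds at most one step
    to a chain. *)
Lemma fincol_step Q w : (forall r, m r -> Q (r *: w)) ->
  fincol (Q +s scyc w) -> fincol Q.
Proof.
move=> mw fQw; have [_ maxQ] := colenP fQw; have [_ _ munit] := locR.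
exists (colen (Q +s scyc w)).+1 => j cj.
have [a [b [ca cb jab]]] := chain_split (N := Q +s scyc w) cj (sle_top _).
move: ca cb; rewrite (sadd_absorb (sle_addl Q (scyc w))).
have -> : Q &s (Q +s scyc w) = Q.
  by apply: submod_eq => u; split=> [[]|q] //; split=> //; apply: sle_addl.
move=> ca /maxQ lb; suff : (a <= 1)%N by lia.
inversion ca as [|? Q' k [QQ' nQQ'] cQ'] => //.
suff e : Q' = Q +s scyc w by move: cQ'; rewrite e => /chain_refl ->.
apply: sle_anti (chain_le cQ') _; apply: sadd_le => // _ [t ->]; apply: subZ.
have [u [qu nu]] : exists u, Q' u /\ ~ Q u.
  apply: contrapT => h; apply: nQQ' => u qu; apply: contrapT => nu.
  by apply: h; exists u.
have /saddP[_ [r ->] q] := chain_le cQ' qu.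
have nr : ~ m r.
  by move=> /mw qr; apply: nu; rewrite -(subrK (r *: w) u); apply: subD.
have [c rc] := munit _ nr; rewrite -[w]scale1r -rc mulrC -scalerA; apply: subZ.
by rewrite -[r *: w](subKr u); apply: subB => //; apply: QQ'.
Qed.

(** The dimension bound leaves [m] as the only possible associated prime of [M/Q] when [Q] contains
    [lpow s n], so [M/Q] is built from simple factors by Noetherian induction. *)
Lemma fincol_lpow s n : sreg s sbot ->
  ~ (exists p : nat -> R -> Prop, prime_chain p (size s).+1) -> fincol (lpow s n).
Proof.
move=> ss dimR.
(* If all multipliers sending a generator [e] into [lmul s stop] were in [P], [prime_descent] would
   give too long a chain; the product of the multipliers found serves all of [M]. *)
have kill (P : R -> Prop) : is_prime P -> ~ Defs.subsetP m P ->
    exists2 c, ~ P c & forall u, lmul s stop (c *: u).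
  move=> pP nmP; have [pI p1 pM] := pP; have [l el] := fin_gen_span Mfg.
  suff [c nc hc] : exists2 c, ~ P c & forall u, span l u -> lmul s stop (c *: u).
    by exists c => // u; apply: hc; rewrite el.
  elim: l {el} => [|e l [c nc hc]].
    by exists 1 => // _ ->; rewrite scaler0; apply: sub0.
  have [c' nc' hc'] : exists2 c', ~ P c' & lmul s stop (c' *: e).
    apply: contrapT => h; apply: dimR.
    have [|p [pp _]] := @prime_descent s sbot P e ss pP nmP; last by exists p.
    rewrite saddC sadd0 => r er; apply: contrapT => nr.
    by apply: h; exists r.
  exists (c' * c); first by case/pM.
  move=> _ [_ [v [[r ->] lv ->]]]; rewrite scalerDr; apply: subD.
    by rewrite scalerA -mulrA mulrC -scalerA; apply: subZ.
  by rewrite -scalerA; apply/subZ/hc.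
have: forall Q, lpow s n <=s Q -> fincol Q; last by apply; apply: sle_refl.
elim/submod_ind => Q IH sQ.
case: (pselect (exists u, ~ Q u)) => [[u /annq_prime_above[w [pw nw _]]]|all]; last first.
  suff -> : Q = stop by exact: fincol_top.
  by apply: sle_anti => // u _; apply: contrapT => nu; apply: all; exists u.
apply: (@fincol_step Q w); last first.
  by apply: IH (slt_scyc nw) _; apply: sle_trans _ sQ (sle_addl _ _).
(* As [c] maps each [lpow s k] into the next, [c ^+ n] kills [w] modulo [Q], which would put [c] in
   the prime [annq Q w]. *)
apply: contrapT => nm; have [|c nc hc] := kill _ pw; first exact: nm.
suff : annq Q w (c ^+ n) by move/(primeX pw).
apply: sQ; elim: (n) => [|n' IHn] //; rewrite exprS -scalerA.
have cl : c *s lpow s n' <=s lpow s n'.+1.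
  elim: n' {IHn} => [|k IHk]; first by move=> _ [v _ ->]; apply: hc.
  have -> : lpow s k.+1 = lmul s (lpow s k) by [].
  rewrite -lmul_smul; exact: lmul_mono.
exact/cl/smulI.
Qed.

End Noetherian.

(** * Comparison with the concrete definitions of the statement *)

Lemma mem_lmul s A x u : x \in s -> A u -> lmul s A (x *: u).
Proof.
move=> + au; elim: s => // y s IH; rewrite inE => /orP[/eqP->|/IH].
  exact: (sle_addl (y *s A) (lmul s A) _ (smulI y au)).
exact: (sle_addr (y *s A) (lmul s A)).
Qed.

Lemma lmul_min s A B : (forall x u, x \in s -> A u -> B (x *: u)) -> lmul s A <=s B.
Proof.
elim: s => [|y s IH] h; first exact: sle0.
apply: sadd_le; first by move=> _ [u au ->]; apply: h => //; rewrite mem_head.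
by apply: IH => x u xs; apply: h; rewrite inE xs orbT.
Qed.

Lemma lmul_gen_ideal s A a u : gen_ideal s a -> A u -> lmul s A (a *: u).
Proof.
move=> [c ->] au; rewrite scaler_suml; apply: sub_sum => i; rewrite -scalerA.
by apply/subZ/mem_lmul => //; apply: mem_nth.
Qed.

Lemma ideal_mod_is_submod (J : R -> Prop) : is_submod (@ideal_mod R M J).
Proof.
split.
- by exists 0%N, (fun=> 0), (fun=> 0); split=> [[]|] //; rewrite big_ord0.
- move=> _ _ [k [r [y [Jr ->]]]] [k' [r' [y' [Jr' ->]]]].
  exists (k + k')%N, (fun i => match split i with inl j => r j | inr j => r' j end),
    (fun i => match split i with inl j => y j | inr j => y' j end).
  split; first by move=> i; case: (split i).
  rewrite big_split_ord /=; congr (_ + _); apply: eq_bigr => i _.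
    by rewrite (unsplitK (inl _ i)).
  by rewrite (unsplitK (inr _ i)).
- move=> t _ [k [r [y [Jr ->]]]]; exists k, r, (fun i => t *: y i); split=> //.
  by rewrite scaler_sumr; apply: eq_bigr => i _; rewrite !scalerA mulrC.
Qed.

Lemma ideal_mod_gen s : @ideal_mod R M (gen_ideal s) = lmul s stop.
Proof.
apply: funext => u; apply: propext; split.
  by move=> [k [r [y [Jr ->]]]]; apply: sub_sum => i; apply: lmul_gen_ideal.
apply: (@lmul_min s stop (Submod (ideal_mod_is_submod (gen_ideal s)))) => x v xs _.
exists 1%N, (fun=> x), (fun=> v); split=> [_|]; first exact: mem_gen_ideal.
by rewrite big_ord1.
Qed.

Lemma ideal_powS (I : R -> Prop) n x r :
  I x -> ideal_pow I n r -> ideal_pow I n.+1 (x * r).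
Proof.
move=> Ix [k [c [a [Ia ->]]]].
exists k, c, (fun j i => if unlift ord0 i is Some i' then a j i' else x); split.
  by move=> j i; case: unlift.
rewrite mulr_sumr; apply: eq_bigr => j _; rewrite big_ord_recl unlift_none mulrCA.
by congr (_ * (_ * _)); apply: eq_bigr => i _; rewrite liftK.
Qed.

Lemma ideal_mod_pow (I : R -> Prop) s n : generates I s ->
  @ideal_mod R M (ideal_pow I n) = lpow s n.
Proof.
move=> gI; apply: funext => u; apply: propext; split.
  move=> [k [r [y [Jr ->]]]]; apply: sub_sum => i.
  have [l [c [a [Ia ->]]]] := Jr i; rewrite scaler_suml; apply: sub_sum => j.
  rewrite -scalerA; apply: subZ; move: (Ia j); move: (a j) => b.
  elim: n {r Jr a Ia} b => [|n IH] b Ib //; rewrite big_ord_recl -scalerA.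
  by apply: lmul_gen_ideal; [apply/gI | apply: IH].
elim: n u => [|n IH] u.
  move=> _; exists 1%N, (fun=> 1), (fun=> u); split; last by rewrite big_ord1 scale1r.
  move=> _; exists 1%N, (fun=> 1), (fun _ _ => 1); split; first by move=> _ [].
  by rewrite big_ord1 big_ord0 mulr1.
apply: (@lmul_min s _ (Submod (ideal_mod_is_submod (ideal_pow I n.+1)))) => x v xs.
move=> /IH[k [r [y [Jr ->]]]]; exists k, (fun i => x * r i), y; split.
  by move=> i; apply: ideal_powS => //; apply/gI/mem_gen_ideal.
by rewrite scaler_sumr; apply: eq_bigr => i _; rewrite scalerA.
Qed.

Lemma regular_seq_depth_ge (m : R -> Prop) s :
  regular_seq M m s -> depth_ge m (size s) sbot.
Proof.
case=> ms rs _; have <- : lmul (take 0 s) stop = sbot by rewrite take0.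
suff h k i : (i + k)%N = size s -> depth_ge m k (lmul (take i s) stop).
  exact: (h _ 0%N).
elim: k i => [|k IH] i // ik; have il : (i < size s)%N by rewrite -ik addnS ltnS leq_addr.
exists s`_i; split; first exact: ms.
  by move=> u; have := rs i il u; rewrite ideal_mod_gen.
have -> : lmul (take i s) stop +s s`_i *s stop = lmul (take i.+1 s) stop.
  by rewrite (take_nth 0) // -cats1 lmul_cat /= sadd0.
by apply: IH; rewrite addSn -ik addnS.
Qed.

Lemma submod_chain_of_chain P Q k :
  chain P Q k -> exists f, @submod_chain R M Q P f k.
Proof.
elim=> [|A B j [AB nBA] _ [f [f0 fk fsub fS]]].
  by exists (fun=> P); split=> // *; apply: carrierP.
exists (fun i => if i is i'.+1 then f i' else carrier A); split=> //.
- by case=> [|i] ij; [apply: carrierP | apply: fsub].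
- case=> [|i] ij; last exact: fS.
  split; first by move=> u /AB /f0.
  apply: contrapT => h; apply: nBA => u /f0 bu; apply: contrapT => na.
  by apply: h; exists u.
Qed.

Lemma chain_of_submod_chain P Q f k : @submod_chain R M Q P f k -> chain P Q k.
Proof.
elim: k Q f => [|k IH] Q f [f0 fk fsub fS].
  suff -> : Q = P by exact: chain0.
  by apply: submod_eq => u; split=> [/f0/fk|/fk/f0].
have [f01 [u [f1u nf0u]]] := fS 0%N isT.
apply: (@chainS _ _ (Submod (fsub 1%N isT))).
  split; first by move=> v /f0/f01.
  by move=> /(_ u f1u) /f0.
by apply: (IH _ (fun i => f i.+1)); split=> // i ik; [apply: fsub | apply: fS].
Qed.

Lemma length_quot_colen P Q : fincol Q -> Q <=s P ->
  @length_quot R M P Q (colen Q - colen P).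
Proof.
move=> fQ QP; have [_ _ cQP maxc] := chain_between fQ QP.
split; first exact: submod_chain_of_chain.
by move=> [f /chain_of_submod_chain/maxc]; rewrite ltnn.
Qed.

End Submodules.

(** Truncating a longer chain would contradict the maximality of the shorter one. *)
Lemma krull_dim_inj (R : comNzRingType) d d' : krull_dim R d -> krull_dim R d' -> d = d'.
Proof.
have le a b : krull_dim R a -> krull_dim R b -> (a <= b)%N.
  move=> [[p [pp ps]] _] [_ nb]; rewrite leqNgt; apply/negP => ba; apply: nb.
  exists p; split=> i ib; first by apply: pp; apply: leq_trans ba.
  by apply: ps; apply: leq_trans ba.
by move=> da db; apply/eqP; rewrite eqn_leq !le.
Qed.

Theorem theorem3p6 (R : comNzRingType) (m : R -> Prop) (d : nat)
  (M : lmodType R) (I : R -> Prop) :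
  noetherian R -> local_ring m -> equichar m -> krull_dim R d -> (0 < d)%N ->
  MCM M m -> primary_to m I -> mu_eq I d.+1 ->
  exists h : nat -> nat, hilbert_fun_is M I h /\ (forall n, (h n <= h n.+1)%N).
Proof.
move=> Rnoeth locR _ dimR d_gt0 [Mfg [d' [dimR' [[s [szs rs]] _]]]] Im [[a [sza Ia]] _].
have dep : depth_ge m d (sbot M).
  by rewrite (krull_dim_inj dimR dimR') -szs; apply: regular_seq_depth_ge.
(* Initially no generator has been replaced and zero is the only submodule to track. *)
have [|bs [y [szb gI sb]]] :=
    @sreg_generators _ M Rnoeth Mfg m locR I d [:: sbot M] [::] a Im sza Ia.
  by move=> Q [<-|].
have {sb} sb : sreg bs (sbot M) by apply: sb; left.
have fJ k : fincol (lpow M bs k).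
  by apply: (fincol_lpow Rnoeth Mfg locR) => //; rewrite szb; case: dimR.
case: bs szb gI sb fJ => [|x bs] szb gI sb fJ; first by rewrite -szb in d_gt0.
(* The truncated subtraction is exact, since the colengths of the powers increase with [n]. *)
exists (fun n => colen (lpow M [:: y, x & bs] n.+1) - colen (lpow M [:: y, x & bs] n))%N.
split=> n; last exact: hilbert_nondecreasing.
rewrite !(ideal_mod_pow _ _ gI); apply: length_quot_colen; last exact: lpowS_le.
by apply: (fincolS (fJ n.+1)); apply: lpow_le_cons.
Qed.
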